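(* Let $n>k\ge1$ be coprime integers, $\eta$ in the upper half-plane, $\Lambda=\mathbb{Z}+\mathbb{Z}\eta$, $E=\mathbb{C}/\Lambda$. For all $\tau\in\mathbb{C}$, there is an isomorphism of graded algebras $Q_{n,k}(E,\tau)^!\cong S_{n,n-k}(E,\tau)$.
   Context: Write $e(z)=e^{2\pi i z}$ and $\theta(z)=\sum_{m\in\mathbb{Z}}(-1)^m e\big(mz+\tfrac12 m(m-1)\eta\big)$. For $\alpha\in\mathbb{Z}$ put $\theta_\alpha(z)=e\big(\alpha z+\tfrac{\alpha}{2n}+\tfrac{\alpha(\alpha-n)}{2n}\eta\big)\prod_{m=0}^{n-1}\theta\big(z+\tfrac mn+\tfrac{\alpha}{n}\eta\big)$, regarded as indexed by $\alpha\in\mathbb{Z}_n$. Let $V$ be an $n$-dimensional complex vector space with basis $x_i$, $i\in\mathbb{Z}_n$, and $TV$ its tensor algebra with $V$ in degree one. For integers $1\le k'<n$ coprime to $n$, $\tau\in\mathbb{C}\setminus\frac1n\Lambda$ and $z\in\mathbb{C}$, define $R_{n,k',\tau}(z)\in\mathrm{End}(V\otimes V)$ by $$R_{n,k',\tau}(z)(x_i\otimes x_j)=\frac{\theta_0(-z)\cdots\theta_{n-1}(-z)}{\theta_1(0)\cdots\theta_{n-1}(0)}\sum_{r\in\mathbb{Z}_n}\frac{\theta_{j-i+r(k'-1)}(-z+\tau)}{\theta_{j-i-r}(-z)\,\theta_{k'r}(\tau)}\,x_{j-r}\otimes x_{i+r}.$$ For $\tau\notin\frac1n\Lambda$ define $Q_{n,k'}(E,\tau):=TV/(\operatorname{im}R_{n,k',\tau}(\tau))$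 and $S_{n,k'}(E,\tau):=TV/(\ker R_{n,k',\tau}(\tau))$; for $\tau\in\frac1n\Lambda$, $R_{n,k',\tau}(\tau)$ is replaced in both definitions by the limit $\lim_{t\to0}R_{n,k',t}(t+\tau)$. For $A=TV/(W)$ with $W\subseteq V\otimes V$, the quadratic dual is $A^!=TV^*/(W^\perp)$, $W^\perp\subseteq V^*\otimes V^*=(V\otimes V)^*$ the annihilator of $W$. *)

(* Defs.v *)
From HB Require Import structures.
From mathcomp Require Import all_boot all_order all_algebra.
From mathcomp Require Import all_classical all_reals all_analysis.
From mathcomp Require Export complex.
Set Implicit Arguments. Unset Strict Implicit. Unset Printing Implicit Defensive.
Import Order.TTheory GRing.Theory Num.Theory.
Import numFieldTopology.Exports numFieldNormedType.Exports.
Local Open Scope ring_scope.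
Local Open Scope classical_set_scope.
Local Open Scope complex_scope.

Section TensorAlgebra.
Variable K : fieldType.

(* V = K^n with basis x_i, i : 'I_n.  An element of TV is a finitely supported
   function on words (the coefficient of x_{w_1} (x) ... (x) x_{w_d}). *)
Definition tens (n : nat) := seq 'I_n -> K.

Definition finsupp n (f : tens n) : Prop :=
  exists N : nat, forall w : seq 'I_n, (N <= size w)%N -> f w = 0.

Definition homog n (d : nat) (f : tens n) : Prop :=
  forall w : seq 'I_n, size w != d -> f w = 0.

Definition tmul n (f g : tens n) : tens n :=
  fun w => \sum_(k < (size w).+1) f (take k w) * g (drop k w).
Definition tunit n : tens n := fun w => (w == [::])%:R.
Definition tzero n : tens n := fun _ => 0.
Definition tlin n (c : K) (f g : tens n) : tens n := fun w => c * f w + g w.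
Definition tsub n (f g : tens n) : tens n := fun w => f w - g w.

(* V (x) V is identified with n x n matrices: x_i (x) x_j <-> delta_mx i j. *)
Definition emb2 n (A : 'M[K]_(n, n)) : tens n :=
  fun w => match w with [:: i; j] => A i j | _ => 0 end.

Definition is_ideal n (I : tens n -> Prop) : Prop :=
  [/\ forall f, I f -> finsupp f,
      I (@tzero n),
      forall c f g, I f -> I g -> I (tlin c f g),
      forall f g, finsupp f -> I g -> I (tmul f g)
    & forall f g, I f -> finsupp g -> I (tmul f g)].

Definition gen_ideal n (W : 'M[K]_(n, n) -> Prop) (f : tens n) : Prop :=
  forall I, is_ideal I -> (forall A, W A -> I (emb2 A)) -> I f.

(* An isomorphism of graded algebras TV1/(W1) ~= TV2/(W2), expressed on
   representatives: a K-linear, degree-preserving map F on the tensor algebras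
   which maps (W1) into (W2), is multiplicative and unital modulo (W2), and
   induces a bijection of the quotients. *)
Definition graded_alg_iso n1 n2 (W1 : 'M[K]_(n1, n1) -> Prop)
    (W2 : 'M[K]_(n2, n2) -> Prop) : Prop :=
  exists F : tens n1 -> tens n2,
  (forall c a b, finsupp a -> finsupp b -> F (tlin c a b) = tlin c (F a) (F b)) /\
  (forall a, finsupp a -> finsupp (F a)) /\
  (forall d a, finsupp a -> homog d a -> homog d (F a)) /\
  (forall a, gen_ideal W1 a -> gen_ideal W2 (F a)) /\
  (forall a b, finsupp a -> finsupp b ->
     gen_ideal W2 (tsub (F (tmul a b)) (tmul (F a) (F b)))) /\
  gen_ideal W2 (tsub (F (@tunit n1)) (@tunit n2)) /\
  (forall a, finsupp a -> gen_ideal W2 (F a) -> gen_ideal W1 a) /\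
  (forall b, finsupp b -> exists2 a, finsupp a & gen_ideal W2 (tsub (F a) b)).

(* annihilator W^perp in V^* (x) V^* = (V (x) V)^dual, where V^* has the dual
   basis y_i and the pairing of y_i (x) y_j with x_a (x) x_b is delta_ia delta_jb. *)
Definition perp n (W : 'M[K]_(n, n) -> Prop) (P : 'M[K]_(n, n)) : Prop :=
  forall A, W A -> \sum_(i < n) \sum_(j < n) P i j * A i j = 0.

Definition imageW n (T : 'M[K]_(n, n) -> 'M[K]_(n, n)) (A : 'M[K]_(n, n)) : Prop :=
  exists B, A = T B.
Definition kernelW n (T : 'M[K]_(n, n) -> 'M[K]_(n, n)) (A : 'M[K]_(n, n)) : Prop :=
  T A = 0.

End TensorAlgebra.

Unset Implicit Arguments.
Section Theta.
Variable R : realType.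
Local Notation C := (R[i]).

Definition ee (z : C) : C :=
  (expR (- (2 * pi * complex.Im z)))%:C *
  ((cos (2 * pi * complex.Re z)) +i* (sin (2 * pi * complex.Re z))).

Definition zsum (a : int -> C) : C :=
  lim ((fun N : nat => (\sum_(i < N.*2.+1) a (i%:Z - N%:Z)%R : R[i]^o)) @ \oo).

Definition theta (eta z : C) : C :=
  zsum (fun m => (-1) ^ m * ee (m%:~R * z + (m%:~R * (m%:~R - 1) / 2) * eta)).

Definition thetaA (n : nat) (eta : C) (alpha : int) (z : C) : C :=
  let a : C := ((alpha %% n%:Z)%Z)%:~R in
  ee (a * z + a / (2 * n%:R) + (a * (a - n%:R) / (2 * n%:R)) * eta) *
  \prod_(m < n) theta eta (z + m%:R / n%:R + (a / n%:R) * eta).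

(* coefficient of x_a (x) x_b in R_{n,k',t}(z)(x_i (x) x_j) *)
Definition Rcoef (n k' : nat) (eta t z : C) (i j a b : 'I_n) : C :=
  (\prod_(m < n) thetaA n eta m%:Z (- z)) /
  (\prod_(1 <= m < n) thetaA n eta m%:Z 0) *
  \sum_(r < n)
    ((a%:Z == ((j%:Z - r%:Z) %% n%:Z)%Z) && (b%:Z == ((i%:Z + r%:Z) %% n%:Z)%Z))%:R *
    (thetaA n eta (j%:Z - i%:Z + r%:Z * (k'%:Z - 1)) (- z + t) /
     (thetaA n eta (j%:Z - i%:Z - r%:Z) (- z) * thetaA n eta (k'%:Z * r%:Z) t)).

Definition in_nLambda (n : nat) (eta tau : C) : Prop :=
  exists a b : int, tau = (a%:~R + b%:~R * eta) / n%:R.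

Definition Rtau_coef (n k' : nat) (eta tau : C) (i j a b : 'I_n) : C :=
  if pselect (in_nLambda n eta tau) then
    lim ((fun t : R[i]^o => (Rcoef n k' eta t (t + tau) i j a b : R[i]^o)) @ (0 : R[i]^o)^')
  else Rcoef n k' eta tau tau i j a b.

Definition Rtau (n k' : nat) (eta tau : C) (A : 'M[C]_(n, n)) : 'M[C]_(n, n) :=
  \matrix_(a < n, b < n) \sum_(i < n) \sum_(j < n) A i j * Rtau_coef n k' eta tau i j a b.

Definition Q_rel (n k' : nat) (eta tau : C) := imageW (Rtau n k' eta tau).
Definition Qdual_rel (n k' : nat) (eta tau : C) := perp (Q_rel n k' eta tau).
Definition S_rel (n k' : nat) (eta tau : C) := kernelW (Rtau n k' eta tau).

End Theta.

Arguments ee {R}.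
Arguments zsum {R}.
Arguments theta {R}.
Arguments thetaA {R}.
Arguments Rcoef {R}.
Arguments in_nLambda {R}.
Arguments Rtau_coef {R}.
Arguments Rtau {R}.
Arguments Q_rel {R}.
Arguments Qdual_rel {R}.
Arguments S_rel {R}.

(* Main.v *)
(** The annihilator of the image of an operator is the kernel of its transpose.
    Writing R(i,j;a,b) for the coefficient of x_a (x) x_b in R(x_i (x) x_j), the
    relation a + b = i + j in Z_n determines r = j - a, and the coefficient is a
    constant independent of k' times
      theta_{k'(j-a)+(a-i)}(t-z) / (theta_{a-i}(-z) theta_{k'(j-a)}(t)).
    The substitution (i,j,a,b) := (-a,-b,-i,-j) preserves a - i and a + b = i + j
    and negates j - a, so it exchanges k' = k and k' = -k.  Hence y_i |-> x_{-i}
    carries the relations of Q_{n,k}^! exactly onto those of S_{n,n-k}. *)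
Require Import Defs.
From HB Require Import structures.
From mathcomp Require Import all_boot all_order all_algebra.
From mathcomp Require Import all_classical all_reals all_analysis.
From mathcomp Require Import complex ring.
Import Order.TTheory GRing.Theory Num.Theory.
Local Open Scope ring_scope.

Section Relabel.
Variable K : fieldType.

(** Pullback of coefficient functions, hence contravariant in [s]: for bijective [s] it is the
    algebra map sending $x_i$ to $x_{s^{-1}(i)}$. *)
Definition relabel {n1 n2} (s : 'I_n2 -> 'I_n1) (f : tens K n1) : tens K n2 :=
  fun w => f (map s w).

Lemma relabelK {n1 n2} {s : 'I_n2 -> 'I_n1} {s' : 'I_n1 -> 'I_n2} :
  cancel s' s -> cancel (relabel s) (relabel s').
Proof.
by move=> sK f; apply/funext => w; rewrite /relabel -map_comp (eq_map sK) map_id.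
Qed.

Lemma relabel_finsupp {n1 n2} (s : 'I_n2 -> 'I_n1) (f : tens K n1) :
  finsupp f -> finsupp (relabel s f).
Proof. by case=> N fN; exists N => w Nw; apply: fN; rewrite size_map. Qed.

Lemma relabel_tmul {n1 n2} (s : 'I_n2 -> 'I_n1) (f g : tens K n1) :
  relabel s (tmul f g) = tmul (relabel s f) (relabel s g).
Proof.
apply/funext => w; rewrite /relabel /tmul size_map.
by apply: eq_bigr => i _; rewrite map_take map_drop.
Qed.

Lemma relabel_tunit {n1 n2} (s : 'I_n2 -> 'I_n1) :
  relabel s (@tunit K n1) = @tunit K n2.
Proof. by apply/funext; case. Qed.

Lemma relabel_emb2 {n1 n2} (s : 'I_n2 -> 'I_n1) (A : 'M[K]_n1) :
  relabel s (emb2 A) = emb2 (mxsub s s A).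
Proof. by apply/funext => -[|i [|j [|l w]]] //=; rewrite mxE. Qed.

(** The preimage of an ideal under an algebra map is an ideal; [s'] serves to recover finite support
    of [f] from that of [relabel s f]. *)
Lemma relabel_ideal {n1 n2} {s : 'I_n2 -> 'I_n1} {s' : 'I_n1 -> 'I_n2}
    {I : tens K n2 -> Prop} :
  cancel s' s -> is_ideal I -> is_ideal (fun f => I (relabel s f)).
Proof.
move=> sK [Ifin I0 Ilin Imull Imulr]; split=> //.
- by move=> f /Ifin/(relabel_finsupp s'); rewrite relabelK.
- by move=> c f g If Ig; exact: Ilin.
- by move=> f g fin_f Ig; rewrite relabel_tmul; apply: Imull => //;
    exact: relabel_finsupp.
- by move=> f g If fin_g; rewrite relabel_tmul; apply: Imulr => //;
    exact: relabel_finsupp.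
Qed.

Lemma relabel_gen_ideal {n1 n2} {s : 'I_n2 -> 'I_n1} {s' : 'I_n1 -> 'I_n2}
    {W1 : 'M[K]_n1 -> Prop} {W2 : 'M[K]_n2 -> Prop} {f : tens K n1} :
  cancel s' s -> (forall A, W1 A -> W2 (mxsub s s A)) ->
  gen_ideal W1 f -> gen_ideal W2 (relabel s f).
Proof.
move=> sK sW W1f I I_ideal IW.
apply: (W1f (fun g => I (relabel s g)) (relabel_ideal sK I_ideal)) => A /sW W2A.
by rewrite relabel_emb2; exact: IW.
Qed.

Lemma gen_ideal_tsubxx {n} (W : 'M[K]_n -> Prop) (f : tens K n) :
  gen_ideal W (tsub f f).
Proof.
move=> I [_ I0 _ _ _] _; suff -> : tsub f f = @tzero K n by [].
by apply/funext => w; rewrite /tsub subrr.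
Qed.

(** [relabel s] respects products and unit exactly, so the required differences are zero;
    [relabel s'] gives bijectivity on the quotients. *)
Lemma relabel_graded_alg_iso {n1 n2} {s : 'I_n2 -> 'I_n1} {s' : 'I_n1 -> 'I_n2}
    {W1 : 'M[K]_n1 -> Prop} {W2 : 'M[K]_n2 -> Prop} :
  cancel s s' -> cancel s' s -> (forall A, W1 A <-> W2 (mxsub s s A)) ->
  graded_alg_iso W1 W2.
Proof.
move=> sK s'K sW; exists (relabel s).
split; first by [].
split; first by move=> a; exact: relabel_finsupp.
split; first by move=> d a _ da w dw; apply: da; rewrite size_map.
split; first by move=> a; apply: (relabel_gen_ideal s'K) => A; rewrite sW.
split; first by move=> a b _ _; rewrite relabel_tmul; exact: gen_ideal_tsubxx.
split; first by rewrite relabel_tunit; exact: gen_ideal_tsubxx.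
split.
  move=> a _ W2a; rewrite -(relabelK s'K a); apply: (relabel_gen_ideal sK) W2a.
  move=> A W2A; apply/sW; suff -> : mxsub s s (mxsub s' s' A) = A by [].
  by apply/matrixP => i j; rewrite !mxE !sK.
move=> b fin_b; exists (relabel s' b); first exact: relabel_finsupp.
by rewrite relabelK//; exact: gen_ideal_tsubxx.
Qed.

Lemma perp_imageW {n} {T : 'M[K]_n -> 'M[K]_n}
    (c : 'I_n -> 'I_n -> 'I_n -> 'I_n -> K) (P : 'M[K]_n) :
  (forall A, T A = \matrix_(a, b) \sum_i \sum_j A i j * c i j a b) ->
  perp (imageW T) P <-> forall i j, \sum_a \sum_b P a b * c i j a b = 0.
Proof.
move=> TE; split=> [PT i j|Pc _ [A ->]].
  (* Pairing with the image of a matrix unit isolates one equation of the transposed system. *)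
  rewrite -[RHS](PT (T (delta_mx i j))); last by exists (delta_mx i j).
  apply: eq_bigr => a _; apply: eq_bigr => b _; congr (_ * _).
  rewrite TE mxE (bigD1 i)//= (bigD1 j)//= mxE !eqxx mul1r.
  rewrite [X in c _ _ _ _ + X]big1 => [|j' /negPf jj']; last first.
    by rewrite mxE jj' andbF mul0r.
  rewrite [X in _ + X]big1 ?addr0// => i' /negPf ii'.
  by rewrite big1// => j' _; rewrite mxE ii' mul0r.
transitivity (\sum_i \sum_j A i j * \sum_a \sum_b P a b * c i j a b).
  under eq_bigr do under eq_bigr do rewrite TE mxE pair_bigA mulr_sumr.
  under [RHS]eq_bigr do under eq_bigr do rewrite pair_bigA mulr_sumr.
  rewrite pair_bigA [RHS]pair_bigA exchange_big; apply: eq_bigr => p _; apply: eq_bigr => q _.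
  by rewrite mulrCA.
by apply: big1 => i _; apply: big1 => j _; rewrite Pc mulr0.
Qed.

End Relabel.

(** Lifts negation in $\mathbb{Z}_{n+1}$ to the integers, so that congruences between indices become
    identities for [ring]. *)
Lemma ord_oppz {n} (i : 'I_n.+1) :
  exists q : int, (- i)%R%:Z = q * n.+1%:Z - i%:Z.
Proof.
exists (1 - ((n.+1 - i) %/ n.+1)%N%:Z).
have := divn_eq (n.+1 - i) n.+1.
move=> /(congr1 Posz); rewrite PoszD PoszM -subzn ?(ltnW (ltn_ord i))// => E.
rewrite /= -[((n.+1 - i) %% n.+1)%N%:Z](addKr (((n.+1 - i) %/ n.+1)%N%:Z * n.+1%:Z)).
rewrite -E; ring.
Qed.

Section Coefficients.
Variable R : realType.

Lemma eq_thetaA (n : nat) (eta : R[i]) (a b : int) (z : R[i]) :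
  (n%:Z %| a - b)%Z -> thetaA n eta a z = thetaA n eta b z.
Proof. by rewrite -eqz_mod_dvd /thetaA => /eqP ->. Qed.

Lemma eq_ord_modz (n : nat) (a : 'I_n) (x : int) :
  (a%:Z == (x %% n%:Z)%Z) = (n%:Z %| a%:Z - x)%Z.
Proof. by rewrite -eqz_mod_dvd (modz_small (m := a%:Z))// ltz_nat ltn_ord. Qed.

Lemma Rcoef_opp (n k : nat) (eta t z : R[i]) (i j a b : 'I_n.+1) :
  (k <= n.+1)%N ->
  Rcoef n.+1 (n.+1 - k) eta t z i j a b =
  Rcoef n.+1 k eta t z (- a) (- b) (- i) (- j).
Proof.
move=> kn; rewrite /Rcoef; congr (_ * _).
(* The prefactor does not involve [k]; the summation index on the right is $j-a$, which the
   substitution negates. *)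
rewrite [RHS](reindex_inj oppr_inj); apply: eq_bigr => r _.
have [qi Ei] := ord_oppz i; have [qj Ej] := ord_oppz j.
have [qa Ea] := ord_oppz a; have [qb Eb] := ord_oppz b.
have [qr Er] := ord_oppz r.
rewrite !eq_ord_modz Ei Ej Ea Eb Er -subzn//.
set N := n.+1%:Z.
have dvdzMND c x : (N %| c * N + x)%Z = (N %| x)%Z by rewrite rpredDl// dvdz_mull.
(* Modulo [N], negation swaps the two support conditions $a=j-r$ and $b=i+r$. *)
have -> : qi * N - i%:Z - (qb * N - b%:Z - (qr * N - r%:Z)) =
    (qi - qb + qr) * N + (b%:Z - (i%:Z + r%:Z)) by ring.
have -> : qj * N - j%:Z - (qa * N - a%:Z + (qr * N - r%:Z)) =
    (qj - qa - qr) * N + (a%:Z - (j%:Z - r%:Z)) by ring.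
rewrite !dvdzMND andbC.
case: (boolP (_ && _)) => [/andP[/dvdzP[p bE] /dvdzP[q aE]]|_]; last by rewrite !mul0r.
have {}bE : b%:Z = p * N + (i%:Z + r%:Z) by rewrite -bE subrK.
have {}aE : a%:Z = q * N + (j%:Z - r%:Z) by rewrite -aE subrK.
(* On the support the three theta indices agree modulo [N]; the witnesses below collect the
   multiples of [N] from the lifts and from $(N-k)r$. *)
rewrite bE aE; congr (_ * (_ / (_ * _))); apply: eq_thetaA; apply/dvdzP.
- by exists (r%:Z - qb + qa + p - q - qr * (k%:Z - 1)); ring.
- by exists (qa - qb + qr + p - q); ring.
- by exists (r%:Z - k%:Z * qr); ring.
Qed.

Lemma Rtau_coef_opp (n k : nat) (eta tau : R[i]) (i j a b : 'I_n.+1) :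
  (k <= n.+1)%N ->
  Rtau_coef n.+1 (n.+1 - k) eta tau i j a b =
  Rtau_coef n.+1 k eta tau (- a) (- b) (- i) (- j).
Proof.
move=> kn; rewrite /Rtau_coef; case: ifP => _; last exact: Rcoef_opp.
(* The functions under the limit agree at every [t], hence so do the values of [lim]. *)
by do 2 f_equal; apply/funext => t; exact: Rcoef_opp.
Qed.

Lemma Qdual_rel_opp (n k : nat) (eta tau : R[i]) (P : 'M[R[i]]_n.+1) :
  (k <= n.+1)%N ->
  Qdual_rel n.+1 k eta tau P <->
  S_rel n.+1 (n.+1 - k) eta tau (mxsub -%R -%R P).
Proof.
move=> kn; rewrite /Qdual_rel /Q_rel (perp_imageW _ (Rtau_coef n.+1 k eta tau))//.
(* Negating both summation indices turns the operator for $n+1-k$ on the relabelled [P] into the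
   transposed operator for [k] on [P], read at $(-a,-b)$. *)
have SE a b : Rtau n.+1 (n.+1 - k) eta tau (mxsub -%R -%R P) a b =
    \sum_i \sum_j P i j * Rtau_coef n.+1 k eta tau (- a) (- b) i j.
  rewrite mxE (reindex_inj oppr_inj); apply: eq_bigr => i _.
  rewrite (reindex_inj oppr_inj); apply: eq_bigr => j _.
  by rewrite mxE Rtau_coef_opp// !opprK.
split=> [P0|/matrixP P0 i j]; first by apply/matrixP => a b; rewrite SE P0 mxE.
by have := P0 (- i) (- j); rewrite SE mxE !opprK.
Qed.

End Coefficients.

(* Q_{n,k}(E,tau)^! ~= S_{n,n-k}(E,tau) as graded algebras. *)
Theorem theorem7p4 (R : realType) (n k : nat) (eta tau : R[i]) :
  (1 <= k)%N -> (k < n)%N -> coprime n k -> 0 < complex.Im eta ->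
  graded_alg_iso (Qdual_rel n k eta tau) (S_rel n (n - k) eta tau).
Proof.
(* $n=0$ contradicts $k<n$; the successor form gives the index type its group structure, where
   negation is its own inverse. *)
case: n => // n _ kn _ _.
apply: (relabel_graded_alg_iso _ opprK opprK) => P.
exact/Qdual_rel_opp/ltnW.
Qed.
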